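(* Let $(B_i)_{i\in I}$ and $(B_{ij})_{i,j\in I}$ be finite families of algebras with $B_{ij}=B_{ji}$ and $B_{ii}=B_i$, and let $\pi^i_j:B_i\to B_{ij}$ be surjective homomorphisms with $\pi^i_i=\mathrm{id}$. Let $$B=\Bigl\{(a_i)_{i\in I}\in\bigoplus_{i\in I}B_i \,\Big|\, \pi^i_j(a_i)=\pi^j_i(a_j)\ \forall i,j\in I\Bigr\}$$ be the gluing of the algebras $B_i$ with respect to the $\pi^i_j$, and let $p_i:B\to B_i$ be the restriction to $B$ of the canonical projection $\bigoplus_{j\in I} B_j\to B_i$. Then $(\ker p_i)_{i\in I}$ is a complete covering of $B$.
   Context: Algebras are associative unital algebras over $\mathbb{C}$; ideals are two-sided; homomorphisms are algebra homomorphisms. A finite family $(J_i)_{i\in I}$ of ideals of an algebra $B$ is a covering of $B$ if $\bigcap_{i\in I} J_i=\{0\}$. Let $q_i:B\to B/J_i$ be the quotient maps and $q^i_j:B/J_i\to B/(J_i+J_j)$, $b+J_i\mapsto b+J_i+J_j$. The covering completion of $B$ with respect to $(J_i)_{i\in I}$ is $B_c=\{(a_i)_{i\in I}\in\bigoplus_{i\in I}B/J_i \mid q^i_j(a_i)=q^j_i(a_j)\ \forall i,j\in I\}$. The covering is called complete if the (injective) homomorphism $K:B\to B_c$, $K(a)=(q_i(a))_{i\in I}$, is surjective. Note that the maps $p_i$ are not assumed surjective. *)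

(* Defs.v *)
From HB Require Import structures.
From mathcomp Require Import all_boot all_order all_algebra.
From mathcomp Require Import boolp classical_sets.

Set Implicit Arguments.
Unset Strict Implicit.
Unset Printing Implicit Defensive.

Import GRing.Theory.
Local Open Scope ring_scope.
Local Open Scope quotient_scope.

(* Associative unital K-algebras in which 1 = 0 is allowed.  The library's    *)
(* algType excludes the zero algebra, which does occur here: B_ij may be 0,   *)
(* J_i + J_j may be the whole algebra, and an empty product is 0.  The scalar *)
(* action is not the library's *: because Hierarchy Builder rejects a new     *)
(* join of lmodType and pzRingType lying below the existing lalgType.         *)
HB.mixin Record PzRing_isPzAlgebra (K : pzRingType) A of GRing.PzRing A := {
  ascale : K -> A -> A;
  ascaleA : forall k l x, ascale k (ascale l x) = ascale (k * l) x;
  ascale1 : forall x, ascale 1 x = x;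
  ascaleDr : forall k x y, ascale k (x + y) = ascale k x + ascale k y;
  ascaleDl : forall k l x, ascale (k + l) x = ascale k x + ascale l x;
  ascaleAl : forall k x y, ascale k (x * y) = ascale k x * y;
  ascaleAr : forall k x y, ascale k (x * y) = x * ascale k y
}.

#[short(type="pzAlgType")]
HB.structure Definition PzAlgebra (K : pzRingType) :=
  { A of GRing.PzRing A & PzRing_isPzAlgebra K A }.

Notation "k **: x" := (ascale k x) (at level 40) : ring_scope.

HB.mixin Record isAlgScalable (K : pzRingType) (A B : pzAlgType K)
    (f : A -> B) := {
  alg_scalable : forall (k : K) x, f (k **: x) = k **: f x
}.

HB.structure Definition PzAlgMorphism (K : pzRingType) (A B : pzAlgType K) :=
  { f of @GRing.RMorphism A B f & isAlgScalable K A B f }.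

Notation "{ 'algmor' A -> B }" := (@PzAlgMorphism.type _ A B)
  (at level 0, A at level 98, B at level 99,
   format "{ 'algmor'  A  ->  B }") : type_scope.

Lemma ascaleBr (K : pzRingType) (A : pzAlgType K) (k : K) (x y : A) :
  k **: (x - y) = k **: x - k **: y.
Proof. by apply/eqP; rewrite -subr_eq opprK -ascaleDr subrK. Qed.

(* Two-sided ideals, not necessarily proper.  Stability under scalars follows *)
(* from k **: x = (k **: 1) * x.                                              *)
HB.mixin Record isTwoSided (A : pzRingType) (S : A -> bool) := {
  ideal_mull : forall a x, x \in (S : {pred A}) -> a * x \in (S : {pred A});
  ideal_mulr : forall a x, x \in (S : {pred A}) -> x * a \in (S : {pred A})
}.

#[short(type="twoSidedIdeal")]
HB.structure Definition TwoSidedIdeal (A : pzRingType) :=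
  { S of GRing.ZmodClosed A S & isTwoSided A S }.

Section Kernel.
Variables (K : pzRingType) (A B : pzAlgType K) (f : {algmor A -> B}).

Definition ker_pred : A -> bool := fun x => f x == 0.

Fact ker_zmod_closed : zmod_closed (ker_pred : {pred A}).
Proof.
split=> [|x y]; rewrite !unfold_in /ker_pred ?raddf0 //.
by move=> /eqP fx /eqP fy; rewrite raddfB /= fx fy subrr.
Qed.

HB.instance Definition _ := GRing.isZmodClosed.Build A ker_pred ker_zmod_closed.

Fact ker_mull a x : x \in (ker_pred : {pred A}) ->
  a * x \in (ker_pred : {pred A}).
Proof. by rewrite !unfold_in /ker_pred rmorphM /= => /eqP->; rewrite mulr0. Qed.

Fact ker_mulr a x : x \in (ker_pred : {pred A}) ->
  x * a \in (ker_pred : {pred A}).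
Proof. by rewrite !unfold_in /ker_pred rmorphM /= => /eqP->; rewrite mul0r. Qed.

HB.instance Definition _ := isTwoSided.Build A ker_pred ker_mull ker_mulr.

Definition ker_ideal := TwoSidedIdeal.clone A ker_pred _.

End Kernel.

Section IdealSum.
Variables (A : pzRingType) (J L : twoSidedIdeal A).

Definition ideal_sum_pred : A -> bool :=
  fun x => `[< exists u v, [/\ u \in J, v \in L & x = u + v] >].

Fact ideal_sum_zmod_closed : zmod_closed (ideal_sum_pred : {pred A}).
Proof.
split=> [|x y].
  by apply/asboolP; exists 0, 0; rewrite !rpred0 addr0.
move=> /asboolP[u [v [uJ vL ->]]] /asboolP[s [t [sJ tL ->]]].
apply/asboolP; exists (u - s), (v - t).
by rewrite !rpredB // opprD addrACA.
Qed.

HB.instance Definition _ :=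
  GRing.isZmodClosed.Build A ideal_sum_pred ideal_sum_zmod_closed.

Fact ideal_sum_mull a x : x \in (ideal_sum_pred : {pred A}) ->
  a * x \in (ideal_sum_pred : {pred A}).
Proof.
move=> /asboolP[u [v [uJ vL ->]]]; apply/asboolP; exists (a * u), (a * v).
by rewrite !ideal_mull // mulrDr.
Qed.

Fact ideal_sum_mulr a x : x \in (ideal_sum_pred : {pred A}) ->
  x * a \in (ideal_sum_pred : {pred A}).
Proof.
move=> /asboolP[u [v [uJ vL ->]]]; apply/asboolP; exists (u * a), (v * a).
by rewrite !ideal_mulr // mulrDl.
Qed.

HB.instance Definition _ :=
  isTwoSided.Build A ideal_sum_pred ideal_sum_mull ideal_sum_mulr.

Definition ideal_sum := TwoSidedIdeal.clone A ideal_sum_pred _.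

Lemma sub_ideal_suml : {subset J <= ideal_sum}.
Proof. by move=> x xJ; apply/asboolP; exists x, 0; rewrite rpred0 addr0. Qed.

Lemma sub_ideal_sumr : {subset L <= ideal_sum}.
Proof. by move=> x xL; apply/asboolP; exists 0, x; rewrite rpred0 add0r. Qed.

End IdealSum.

Section QuotientAlgebra.
Variables (K : pzRingType) (A : pzAlgType K) (J : twoSidedIdeal A).

(* The library's quotient of an additive group by a subgroup, given the       *)
(* algebra structure below (the library only does commutative rings).         *)
Definition quot_alg := Quotient.quot J.

HB.instance Definition _ := GRing.Zmodule.on quot_alg.

Definition quot_pi (x : A) : quot_alg := \pi_quot_alg x.

Lemma quot_piP x y : reflect (quot_pi x = quot_pi y) (x - y \in J).
Proof. by rewrite Quotient.idealrBE; apply: eqP. Qed.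

Lemma quot_pi_surj (q : quot_alg) : quot_pi (repr q) = q.
Proof. by rewrite /quot_pi reprK. Qed.

Lemma quot_repr_pi x : x - repr (quot_pi x) \in J.
Proof. by apply/quot_piP; rewrite quot_pi_surj. Qed.

Fact quot_pi_is_zmod_morphism : zmod_morphism quot_pi.
Proof. exact: (raddfB (\pi_(Quotient.quot J))). Qed.

HB.instance Definition _ :=
  GRing.isZmodMorphism.Build A quot_alg quot_pi quot_pi_is_zmod_morphism.

Definition quot_one : quot_alg := quot_pi 1.
Definition quot_mul (p q : quot_alg) : quot_alg := quot_pi (repr p * repr q).
Definition quot_scale (k : K) (p : quot_alg) : quot_alg :=
  quot_pi (k **: repr p).

Lemma quot_pi_mul x y : quot_pi (x * y) = quot_mul (quot_pi x) (quot_pi y).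
Proof.
apply/quot_piP; rewrite -[x * y](addrNK (x * repr (quot_pi y))) -mulrBr.
rewrite -addrA -mulrBl rpredD //.
  exact/ideal_mull/quot_repr_pi.
exact/ideal_mulr/quot_repr_pi.
Qed.

Lemma quot_pi_scale k x : quot_pi (k **: x) = quot_scale k (quot_pi x).
Proof.
apply/quot_piP; rewrite -ascaleBr -[_ - _]mul1r ascaleAl.
exact/ideal_mull/quot_repr_pi.
Qed.

Fact quot_mulA : associative quot_mul.
Proof.
move=> p q r; rewrite -[p]quot_pi_surj -[q]quot_pi_surj -[r]quot_pi_surj.
by rewrite -!quot_pi_mul mulrA.
Qed.

Fact quot_mul1r : left_id quot_one quot_mul.
Proof. by move=> p; rewrite -[p]quot_pi_surj -quot_pi_mul mul1r. Qed.

Fact quot_mulr1 : right_id quot_one quot_mul.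
Proof. by move=> p; rewrite -[p]quot_pi_surj -quot_pi_mul mulr1. Qed.

Fact quot_mulrDl : left_distributive quot_mul +%R.
Proof.
move=> p q r; rewrite -[p]quot_pi_surj -[q]quot_pi_surj -[r]quot_pi_surj.
by rewrite -raddfD -!quot_pi_mul mulrDl raddfD.
Qed.

Fact quot_mulrDr : right_distributive quot_mul +%R.
Proof.
move=> p q r; rewrite -[p]quot_pi_surj -[q]quot_pi_surj -[r]quot_pi_surj.
by rewrite -raddfD -!quot_pi_mul mulrDr raddfD.
Qed.

HB.instance Definition _ := GRing.Zmodule_isPzRing.Build quot_alg
  quot_mulA quot_mul1r quot_mulr1 quot_mulrDl quot_mulrDr.

Fact quot_scaleA k l p : quot_scale k (quot_scale l p) = quot_scale (k * l) p.
Proof. by rewrite -[p]quot_pi_surj -!quot_pi_scale ascaleA. Qed.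

Fact quot_scale1 p : quot_scale 1 p = p.
Proof. by rewrite -[p]quot_pi_surj -quot_pi_scale ascale1. Qed.

Fact quot_scaleDr k p q :
  quot_scale k (p + q) = quot_scale k p + quot_scale k q.
Proof.
rewrite -[p]quot_pi_surj -[q]quot_pi_surj.
by rewrite -raddfD -!quot_pi_scale ascaleDr raddfD.
Qed.

Fact quot_scaleDl k l p :
  quot_scale (k + l) p = quot_scale k p + quot_scale l p.
Proof. by rewrite -[p]quot_pi_surj -!quot_pi_scale ascaleDl raddfD. Qed.

Fact quot_scaleAl k (p q : quot_alg) :
  quot_scale k (p * q) = quot_scale k p * q.
Proof.
rewrite -[p]quot_pi_surj -[q]quot_pi_surj.
by rewrite /GRing.mul /= -!(quot_pi_mul, quot_pi_scale) ascaleAl.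
Qed.

Fact quot_scaleAr k (p q : quot_alg) :
  quot_scale k (p * q) = p * quot_scale k q.
Proof.
rewrite -[p]quot_pi_surj -[q]quot_pi_surj.
by rewrite /GRing.mul /= -!(quot_pi_mul, quot_pi_scale) ascaleAr.
Qed.

HB.instance Definition _ := PzRing_isPzAlgebra.Build K quot_alg
  quot_scaleA quot_scale1 quot_scaleDr quot_scaleDl quot_scaleAl quot_scaleAr.

Fact quot_pi_is_monoid_morphism : monoid_morphism quot_pi.
Proof. by split=> [|x y] //; apply: quot_pi_mul. Qed.

HB.instance Definition _ :=
  GRing.isMonoidMorphism.Build A quot_alg quot_pi quot_pi_is_monoid_morphism.

HB.instance Definition _ :=
  isAlgScalable.Build K A quot_alg quot_pi quot_pi_scale.

End QuotientAlgebra.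

Section QuotientMap.
Variables (K : pzRingType) (A : pzAlgType K) (J L : twoSidedIdeal A).
Hypothesis sJL : {subset J <= L}.

(* The homomorphism A / J -> A / L, a + J |-> a + L, for J contained in L.    *)
Definition quot_map of {subset J <= L} :=
  fun q : quot_alg J => quot_pi L (repr q).

Local Notation qm := (quot_map sJL).

Lemma quot_mapE x : qm (quot_pi J x) = quot_pi L x.
Proof.
by apply/quot_piP; rewrite -opprB rpredN; apply/sJL/quot_repr_pi.
Qed.

Fact quot_map_is_zmod_morphism : zmod_morphism qm.
Proof.
move=> p q; rewrite -[p]quot_pi_surj -[q]quot_pi_surj.
by rewrite -raddfB !quot_mapE raddfB.
Qed.

HB.instance Definition _ := GRing.isZmodMorphism.Build
  (quot_alg J) (quot_alg L) qm quot_map_is_zmod_morphism.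

Fact quot_map_is_monoid_morphism : monoid_morphism qm.
Proof.
split=> [|p q]; first exact: quot_mapE.
rewrite -[p]quot_pi_surj -[q]quot_pi_surj.
by rewrite -rmorphM !quot_mapE rmorphM.
Qed.

HB.instance Definition _ := GRing.isMonoidMorphism.Build
  (quot_alg J) (quot_alg L) qm quot_map_is_monoid_morphism.

Fact quot_map_scalable k q : qm (k **: q) = k **: qm q.
Proof.
rewrite -[q]quot_pi_surj.
by rewrite -alg_scalable !quot_mapE alg_scalable.
Qed.

HB.instance Definition _ := isAlgScalable.Build K
  (quot_alg J) (quot_alg L) qm quot_map_scalable.

End QuotientMap.

Arguments quot_map {K A J L} sJL q.

Section Product.
Variables (K : pzRingType) (I : finType) (A : I -> pzAlgType K).

Definition prod_alg := {dffun forall i : I, A i}.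

HB.instance Definition _ := Choice.on prod_alg.

Definition prod_zero : prod_alg := [ffun i => 0 : A i].
Definition prod_opp (a : prod_alg) : prod_alg := [ffun i => - a i].
Definition prod_add (a b : prod_alg) : prod_alg := [ffun i => a i + b i].
Definition prod_one : prod_alg := [ffun i => 1 : A i].
Definition prod_mul (a b : prod_alg) : prod_alg := [ffun i => a i * b i].
Definition prod_scale (k : K) (a : prod_alg) : prod_alg :=
  [ffun i => k **: a i].

Fact prod_addA : associative prod_add.
Proof. by move=> a b c; apply/ffunP=> i; rewrite !ffunE addrA. Qed.

Fact prod_addC : commutative prod_add.
Proof. by move=> a b; apply/ffunP=> i; rewrite !ffunE addrC. Qed.

Fact prod_add0 : left_id prod_zero prod_add.
Proof. by move=> a; apply/ffunP=> i; rewrite !ffunE add0r. Qed.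

Fact prod_addN : left_inverse prod_zero prod_opp prod_add.
Proof. by move=> a; apply/ffunP=> i; rewrite !ffunE addNr. Qed.

HB.instance Definition _ := GRing.isZmodule.Build prod_alg
  prod_addA prod_addC prod_add0 prod_addN.

Fact prod_mulA : associative prod_mul.
Proof. by move=> a b c; apply/ffunP=> i; rewrite !ffunE mulrA. Qed.

Fact prod_mul1r : left_id prod_one prod_mul.
Proof. by move=> a; apply/ffunP=> i; rewrite !ffunE mul1r. Qed.

Fact prod_mulr1 : right_id prod_one prod_mul.
Proof. by move=> a; apply/ffunP=> i; rewrite !ffunE mulr1. Qed.

Fact prod_mulDl : left_distributive prod_mul +%R.
Proof. by move=> a b c; apply/ffunP=> i; rewrite !ffunE mulrDl. Qed.

Fact prod_mulDr : right_distributive prod_mul +%R.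
Proof. by move=> a b c; apply/ffunP=> i; rewrite !ffunE mulrDr. Qed.

HB.instance Definition _ := GRing.Zmodule_isPzRing.Build prod_alg
  prod_mulA prod_mul1r prod_mulr1 prod_mulDl prod_mulDr.

Fact prod_scaleA k l a : prod_scale k (prod_scale l a) = prod_scale (k * l) a.
Proof. by apply/ffunP=> i; rewrite !ffunE ascaleA. Qed.

Fact prod_scale1 a : prod_scale 1 a = a.
Proof. by apply/ffunP=> i; rewrite !ffunE ascale1. Qed.

Fact prod_scaleDr k a b :
  prod_scale k (a + b) = prod_scale k a + prod_scale k b.
Proof. by apply/ffunP=> i; rewrite !ffunE ascaleDr. Qed.

Fact prod_scaleDl k l a :
  prod_scale (k + l) a = prod_scale k a + prod_scale l a.
Proof. by apply/ffunP=> i; rewrite !ffunE ascaleDl. Qed.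

Fact prod_scaleAl k (a b : prod_alg) :
  prod_scale k (a * b) = prod_scale k a * b.
Proof. by apply/ffunP=> i; rewrite !ffunE ascaleAl. Qed.

Fact prod_scaleAr k (a b : prod_alg) :
  prod_scale k (a * b) = a * prod_scale k b.
Proof. by apply/ffunP=> i; rewrite !ffunE ascaleAr. Qed.

HB.instance Definition _ := PzRing_isPzAlgebra.Build K prod_alg
  prod_scaleA prod_scale1 prod_scaleDr prod_scaleDl prod_scaleAl prod_scaleAr.

End Product.

(* The subalgebra of the families (a_i)_i with f_ij(a_i) = g_ij(a_j) for all  *)
(* i and j.  Both the gluing of a family of algebras and the covering         *)
(* completion are of this form.                                               *)
Section Gluing.
Variables (K : pzRingType) (I : finType) (A : I -> pzAlgType K).
Variable D : I -> I -> pzAlgType K.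
Variables (f : forall i j, {algmor A i -> D i j}).
Variables (g : forall i j, {algmor A j -> D i j}).

Definition compatible : prod_alg A -> bool :=
  fun a => [forall i, forall j, f i j (a i) == g i j (a j)].

Lemma compatibleP (a : prod_alg A) :
  reflect (forall i j, f i j (a i) = g i j (a j)) (compatible a).
Proof. exact: 'forall_'forall_eqP. Qed.

Fact compatible_subring_closed :
  subring_closed (compatible : {pred prod_alg A}).
Proof.
split=> [|a b /compatibleP Ca /compatibleP Cb
          |a b /compatibleP Ca /compatibleP Cb];
  apply/compatibleP=> i j; rewrite !ffunE.
- by rewrite !rmorph1.
- by rewrite !rmorphD !rmorphN /= Ca Cb.
- by rewrite !rmorphM /= Ca Cb.
Qed.

Fact compatible_scale k (a : prod_alg A) : compatible a -> compatible (k **: a).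
Proof.
move=> /compatibleP Ca; apply/compatibleP=> i j.
by rewrite !ffunE !alg_scalable Ca.
Qed.

Record glued_alg :=
  Glued { glued_val : prod_alg A; gluedP : compatible glued_val }.

HB.instance Definition _ := [isSub for glued_val].
HB.instance Definition _ := [Choice of glued_alg by <:].
HB.instance Definition _ := GRing.SubChoice_isSubPzRing.Build
  (prod_alg A) compatible glued_alg compatible_subring_closed.

Definition glued_scale (k : K) (a : glued_alg) : glued_alg :=
  Glued (compatible_scale k (gluedP a)).

Fact glued_scaleA k l a :
  glued_scale k (glued_scale l a) = glued_scale (k * l) a.
Proof. exact/val_inj/ascaleA. Qed.

Fact glued_scale1 a : glued_scale 1 a = a.
Proof. exact/val_inj/ascale1. Qed.

Fact glued_scaleDr k a b :
  glued_scale k (a + b) = glued_scale k a + glued_scale k b.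
Proof. exact/val_inj/ascaleDr. Qed.

Fact glued_scaleDl k l a :
  glued_scale (k + l) a = glued_scale k a + glued_scale l a.
Proof. exact/val_inj/ascaleDl. Qed.

Fact glued_scaleAl k a b : glued_scale k (a * b) = glued_scale k a * b.
Proof. exact/val_inj/ascaleAl. Qed.

Fact glued_scaleAr k a b : glued_scale k (a * b) = a * glued_scale k b.
Proof. exact/val_inj/ascaleAr. Qed.

HB.instance Definition _ := PzRing_isPzAlgebra.Build K glued_alg
  glued_scaleA glued_scale1 glued_scaleDr glued_scaleDl glued_scaleAl
  glued_scaleAr.

Definition glued_proj (i : I) (a : glued_alg) : A i := glued_val a i.

Fact glued_proj_is_zmod_morphism i : zmod_morphism (@glued_proj i).
Proof. by move=> a b; rewrite /glued_proj !ffunE. Qed.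

Fact glued_proj_is_monoid_morphism i : monoid_morphism (@glued_proj i).
Proof. by split=> [|a b]; rewrite /glued_proj !ffunE. Qed.

Fact glued_proj_scalable i k a : glued_proj i (k **: a) = k **: glued_proj i a.
Proof. by rewrite /glued_proj !ffunE. Qed.

HB.instance Definition _ i := GRing.isZmodMorphism.Build glued_alg (A i)
  (@glued_proj i) (glued_proj_is_zmod_morphism i).
HB.instance Definition _ i := GRing.isMonoidMorphism.Build glued_alg (A i)
  (@glued_proj i) (glued_proj_is_monoid_morphism i).
HB.instance Definition _ i := isAlgScalable.Build K glued_alg (A i)
  (@glued_proj i) (glued_proj_scalable i).

End Gluing.

Section Covering.
Variables (K : pzRingType) (B : pzAlgType K) (I : finType).
Variable J : I -> twoSidedIdeal B.

Definition is_covering : Prop :=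
  (\bigcap_(i in [set: I]) [set b : B | b \in J i] = [set 0 : B])%classic.

(* q^i_j and q^j_i, both with values in B / (J_i + J_j).                      *)
Definition quot_left i j :
    {algmor quot_alg (J i) -> quot_alg (ideal_sum (J i) (J j))} :=
  quot_map (@sub_ideal_suml _ (J i) (J j)).

Definition quot_right i j :
    {algmor quot_alg (J j) -> quot_alg (ideal_sum (J i) (J j))} :=
  quot_map (@sub_ideal_sumr _ (J i) (J j)).

Definition covering_completion : pzAlgType K := glued_alg quot_left quot_right.

Definition quot_family (b : B) : prod_alg (fun i => quot_alg (J i)) :=
  [ffun i => quot_pi (J i) b].

Lemma quot_family_compatible b :
  compatible quot_left quot_right (quot_family b).
Proof.
by apply/compatibleP=> i j; rewrite !ffunE [LHS]quot_mapE [RHS]quot_mapE.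
Qed.

Definition completion_map (b : B) : covering_completion :=
  Glued (quot_family_compatible b).

Fact completion_map_is_zmod_morphism : zmod_morphism completion_map.
Proof.
by move=> x y; apply/val_inj/ffunP=> i; rewrite !ffunE raddfB.
Qed.

Fact completion_map_is_monoid_morphism : monoid_morphism completion_map.
Proof.
by split=> [|x y]; apply/val_inj/ffunP=> i; rewrite !ffunE (rmorph1, rmorphM).
Qed.

Fact completion_map_scalable k x :
  completion_map (k **: x) = k **: completion_map x.
Proof. by apply/val_inj/ffunP=> i; rewrite !ffunE alg_scalable. Qed.

HB.instance Definition _ := GRing.isZmodMorphism.Build
  B covering_completion completion_map completion_map_is_zmod_morphism.
HB.instance Definition _ := GRing.isMonoidMorphism.Build
  B covering_completion completion_map completion_map_is_monoid_morphism.
HB.instance Definition _ := isAlgScalable.Build K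
  B covering_completion completion_map completion_map_scalable.

Definition is_complete_covering : Prop :=
  is_covering /\ forall y : covering_completion, exists b, completion_map b = y.

End Covering.

Section Transport.
Variables (K : pzRingType).

(* Transport along an equality of algebras; the identity when A and A' are    *)
(* the same algebra.                                                          *)
Definition alg_cast (A A' : pzAlgType K) (e : A = A') (x : A) : A' :=
  ecast X (PzAlgebra.sort X) e x.

Section Composition.
Variables (A0 A A' : pzAlgType K) (e : A = A') (f : {algmor A0 -> A}).

Definition cast_comp (x : A0) : A' := alg_cast e (f x).

Fact cast_comp_is_zmod_morphism : zmod_morphism cast_comp.
Proof.
by rewrite /cast_comp; case: A' / e => x y; rewrite [LHS]raddfB.
Qed.

Fact cast_comp_is_monoid_morphism : monoid_morphism cast_comp.
Proof.
rewrite /cast_comp; case: A' / e; split=> [|x y]; first exact: (rmorph1 f).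
exact: (rmorphM f).
Qed.

Fact cast_comp_scalable k x : cast_comp (k **: x) = k **: cast_comp x.
Proof. by rewrite /cast_comp; case: A' / e; exact: alg_scalable. Qed.

HB.instance Definition _ :=
  GRing.isZmodMorphism.Build A0 A' cast_comp cast_comp_is_zmod_morphism.
HB.instance Definition _ :=
  GRing.isMonoidMorphism.Build A0 A' cast_comp cast_comp_is_monoid_morphism.
HB.instance Definition _ :=
  isAlgScalable.Build K A0 A' cast_comp cast_comp_scalable.

End Composition.
End Transport.

(* B2C realises B_ij = B_ji, so that both sides of the gluing condition       *)
(* pi^i_j(a_i) = pi^j_i(a_j) lie in B_ij.                                     *)
Section GluingOfAlgebras.
Variables (K : pzRingType) (I : finType) (B : I -> pzAlgType K).
Variables (B2 : I -> I -> pzAlgType K) (B2C : forall i j, B2 i j = B2 j i).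
Variable pi : forall i j, {algmor B i -> B2 i j}.

Definition gluing_left i j : {algmor B i -> B2 i j} := pi i j.

Definition gluing_right i j : {algmor B j -> B2 i j} :=
  cast_comp (B2C j i) (pi j i).

Definition gluing : pzAlgType K := glued_alg gluing_left gluing_right.

Definition gluing_proj (i : I) : {algmor gluing -> B i} :=
  @glued_proj _ _ _ _ gluing_left gluing_right i.

End GluingOfAlgebras.

(* Main.v *)
(* Lift a compatible family of classes to elements b_i of the gluing and glue *)
(* the a_i = p_i(b_i).  Writing b_i - b_j = u + v with p_i(u) = 0 = p_j(v),   *)
(* the gluing conditions satisfied by v and by b_j give                       *)
(*   pi^i_j(a_i) = pi^i_j(p_i(b_j)) + pi^i_j(p_i(v))                          *)
(*               = pi^j_i(a_j) + pi^j_i(p_j(v)) = pi^j_i(a_j).                *)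
Require Import Defs.
From mathcomp Require Import all_boot all_order all_algebra.
From mathcomp Require Import boolp classical_sets.
From mathcomp Require Import reals complex.

Import GRing.Theory.
Local Open Scope ring_scope.

(** An element of the gluing is determined by its components, so the kernels intersect in 0.
    Completeness rests on [ker_proj_sum_compatible]: congruence modulo the sum of two kernels
    already forces the gluing condition between the two components. *)

Section GluedCovering.
Context {K : pzRingType} {I : finType} {A : I -> pzAlgType K}.
Context {D : I -> I -> pzAlgType K}.
Context {f : forall i j, {algmor A i -> D i j}}.
Context {g : forall i j, {algmor A j -> D i j}}.

Local Notation p i := (@glued_proj _ _ _ _ f g i : {algmor _ -> _}).

Lemma glued_proj_compatible i j a : f i j (p i a) = g i j (p j a).
Proof. by have /compatibleP := gluedP a; apply. Qed.

Lemma mem_ker_proj i a : (a \in ker_ideal (p i)) = (p i a == 0).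
Proof. by []. Qed.

Lemma ker_proj_covering : is_covering (fun i => ker_ideal (p i)).
Proof.
apply/seteqP; split=> [a /= ker_a | _ -> i _ /=]; last exact: rpred0.
apply/val_inj/ffunP=> i /=; rewrite [RHS]ffunE.
exact/eqP/(ker_a i).
Qed.

Lemma ker_proj_sum_compatible i j x y :
    x - y \in ideal_sum (ker_ideal (p i)) (ker_ideal (p j)) ->
  f i j (p i x) = g i j (p j y).
Proof.
move=> /asboolP[u [v []]]; rewrite !mem_ker_proj => /eqP pu /eqP pv /eqP.
rewrite subr_eq => /eqP ->; rewrite !rmorphD /= pu rmorph0 add0r.
by rewrite !glued_proj_compatible pv rmorph0 add0r.
Qed.

Lemma ker_proj_complete_covering :
  is_complete_covering (fun i => ker_ideal (p i)).
Proof.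
split; first exact: ker_proj_covering.
case=> y y_compat; pose b i := repr (y i).
have bE i : quot_pi (ker_ideal (p i)) (b i) = y i by exact: quot_pi_surj.
have a_compat : compatible f g [ffun i => p i (b i)].
  apply/compatibleP=> i j; rewrite !ffunE; apply: ker_proj_sum_compatible.
  (* Compatibility of the classes says that [b i] and [b j] agree modulo the sum of the two
     kernels. *)
  apply/quot_piP; move/compatibleP: y_compat => /(_ i j).
  by rewrite -!bE [LHS]quot_mapE [RHS]quot_mapE.
exists (Glued a_compat); apply/val_inj/ffunP=> i /=.
(* The glued element and [b i] have the same [i]-th component, hence the same class modulo the
   kernel of [p i]. *)
rewrite ffunE -bE; apply/quot_piP.
by rewrite mem_ker_proj rmorphB /= {1}/glued_proj ffunE subrr.
Qed.

End GluedCovering.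

Theorem proposition8 (R : realType) (I : finType)
    (B : I -> pzAlgType R[i]) (B2 : I -> I -> pzAlgType R[i])
    (B2C : forall i j : I, B2 i j = B2 j i)
    (B2d : forall i : I, B2 i i = B i)
    (pi : forall i j : I, {algmor B i -> B2 i j})
    (pi_surj : forall (i j : I) (y : B2 i j), exists x : B i, pi i j x = y)
    (pi_id : forall (i : I) (x : B i), alg_cast (B2d i) (pi i i x) = x) :
  is_complete_covering (fun i : I => ker_ideal (gluing_proj B2C pi i)).
Proof. exact: ker_proj_complete_covering. Qed.
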